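(* Consider the general case in which the log-likelihood ratio $\ell$ is unbounded. For any $\epsilon>0$, $\delta\in(0,1)$, $b>2$, and the corresponding $A_\delta$, the $\delta$-DP-CUSUM stopping time $\tilde T(b)$ (Laplace noise scale $2A_\delta/\epsilon$) satisfies $$\mathbf E_\infty[\tilde T(b)]\ge\frac{e^{h(\epsilon,A_\delta)\,b-2}}{4(b+1)^2},\qquad h(\epsilon,A_\delta)=\min\Big\{\frac{\epsilon}{2A_\delta},1\Big\}.$$
   Context: Let $f_0\ne f_1$ be two known distinct probability density functions on $\mathbb R^k$ (pre- and post-change densities) and let $\ell(x)=\log(f_1(x)/f_0(x))$ be the log-likelihood ratio. For a data sequence $X_1,X_2,\ldots\in\mathbb R^k$, the CUSUM statistics are $S_0=0$ and, for $t\ge1$, $S_t=\max(0,S_{t-1})+\ell(X_t)$. For $\delta\in(0,1)$ define $$A_\delta=\inf\Big\{t:\max_{i=0,1}\mathbf P_{X\sim f_i}\big(2|\ell(X)|\ge t\big)\le\delta/2\Big\}.$$ $\mathrm{Lap}(\beta)$ denotes the Laplace distribution with density $\exp(-|x|/\beta)/(2\beta)$, $\beta>0$ (so it is understood that $A_\delta>0$). The $\delta$-DP-CUSUM procedure uses $\tilde S_t=S_t+Z_t$, where $Z_1,Z_2,\ldots$ are i.i.d. $\mathrm{Lap}(2A_\delta/\epsilon)$, and a single $W\sim\mathrm{Lap}(2A_\delta/\epsilon)$; $(Z_t)_{t\ge1}$, $W$ and the data are mutually independent. The stopping time with deterministic threshold $b$ is $\tilde T(b)=\inf\{t>0:\tilde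 S_t\ge b+W\}$. $\mathbf E_\infty$ denotes expectation under the joint law in which $X_1,X_2,\ldots$ are i.i.d. with density $f_0$ (no change occurs), together with the Laplace noises $(Z_t)$ and $W$ above. *)

(* Defs.v *)
From HB Require Import structures.
From mathcomp Require Import all_boot all_order all_algebra.
From mathcomp Require Import finmap.
From mathcomp Require Import all_classical all_reals all_analysis.

Set Implicit Arguments.
Unset Strict Implicit.
Unset Printing Implicit Defensive.

Import Order.TTheory GRing.Theory Num.Theory.
Import numFieldNormedType.Exports.

Local Open Scope classical_set_scope.
Local Open Scope ring_scope.

Section cons_measure.
Context {d} {T : measurableType d} {R : realType} {k : nat}.
Variable mu : {sigma_finite_measure set T -> \bar R}.
Variable m : {sigma_finite_measure set k.-tuple T -> \bar R}.

Definition tuple_cons (p : T * k.-tuple T) : k.+1.-tuple T :=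
  [tuple of p.1 :: p.2].

Lemma measurable_tuple_cons : measurable_fun [set: T * k.-tuple T] tuple_cons.
Proof. exact: measurable_cons. Qed.

Definition cons_measure : set (k.+1.-tuple T) -> \bar R :=
  pushforward (mu \x m)%E tuple_cons.

Let cons_measure0 : cons_measure set0 = 0%E.
Proof. by rewrite /cons_measure /pushforward preimage_set0 measure0. Qed.

Let cons_measure_ge0 A : (0 <= cons_measure A)%E.
Proof. by rewrite /cons_measure /pushforward; exact: measure_ge0. Qed.

Let cons_measure_sigma_additive : semi_sigma_additive cons_measure.
Proof.
move=> F mF tF mUF; rewrite /cons_measure /pushforward preimage_bigcup.
apply: measure_semi_sigma_additive.
- by move=> n; rewrite -[X in measurable X]setTI; exact: measurable_tuple_cons.
- apply/trivIsetP => /= i j _ _ ij; rewrite -preimage_setI.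
  by move/trivIsetP : tF => /(_ _ _ _ _ ij) ->//; rewrite preimage_set0.
- by rewrite -preimage_bigcup -[X in measurable X]setTI;
    exact: measurable_tuple_cons.
Qed.

HB.instance Definition _ := isMeasure.Build _ _ _ cons_measure
  cons_measure0 cons_measure_ge0 cons_measure_sigma_additive.

Let cons_measure_sigma_finite : sigma_finite setT cons_measure.
Proof.
have /sigma_finiteP[F [TF ndF Foo]] := sigma_finiteT mu.
have /sigma_finiteP[G [TG ndG Goo]] := sigma_finiteT m.
pose g (x : k.+1.-tuple T) : T * k.-tuple T := (thead x, [tuple of behead x]).
have mg : measurable_fun setT g.
  by apply: measurable_fun_pair; [exact: measurable_tnth|exact: measurable_behead].
have gK : cancel tuple_cons g.
  by move=> [x t]; rewrite /g theadE; congr pair; exact: val_inj.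
exists (fun n => g @^-1` (F n `*` G n)).
  rewrite -preimage_bigcup -(preimage_setT g) -setXTT TF TG; congr (_ @^-1` _).
  rewrite predeqE => -[x y]; split.
    move=> [/= [n _ Fnx] [l _ Gly]]; exists (maxn n l) => //; split.
    - by move: x Fnx; exact/subsetPset/ndF/leq_maxl.
    - by move: y Gly; exact/subsetPset/ndG/leq_maxr.
  by move=> [n _ []/= ? ?]; split; exists n.
move=> n; have [? ?] := Foo n; have [? ?] := Goo n; split.
  by rewrite -[X in measurable X]setTI; apply: mg => //; exact: measurableX.
rewrite /cons_measure /pushforward -comp_preimage.
rewrite (_ : g \o tuple_cons = id) ?preimage_id; last exact/funext.
by rewrite product_measure1E// lte_mul_pinfty// ge0_fin_numE.
Qed.

HB.instance Definition _ := Measure_isSigmaFinite.Build _ _ _ cons_measure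
  cons_measure_sigma_finite.

End cons_measure.

Section power_measure.
Context {d} {T : measurableType d} {R : realType}.
Variable mu : {sigma_finite_measure set T -> \bar R}.

(** The k-fold product mu \x ... \x mu on k-tuples. *)
Fixpoint power_measure k : {sigma_finite_measure set k.-tuple T -> \bar R} :=
  match k with
  | 0 => \d_ [tuple]
  | k'.+1 => cons_measure mu (power_measure k')
  end.

Lemma power_measureE k (A : 'I_k -> set T) : (forall i, measurable (A i)) ->
  power_measure k [set x | forall i, A i (tnth x i)] = (\prod_(i < k) mu (A i))%E.
Proof.
elim: k => [|k IH] in A * => mA.
  by rewrite big_ord0 /= diracE mem_set// => -[].
rewrite big_ord_recl -IH//.
have -> : power_measure k.+1 [set x | forall i, A i (tnth x i)] = 
  (mu \x power_measure k)%E (A ord0 `*` [set x | forall i, A (lift ord0 i) (tnth x i)]).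
  congr ((_ \x _) _)%E; apply/seteqP; split => -[x t] /=.
    by move=> H; split; [have := H ord0|move=> i; have := H (lift ord0 i); rewrite tnthS].
  by move=> [H0 H] i; case: (unliftP ord0 i) => [j ->|->//]; rewrite tnthS.
rewrite product_measure1E//.
rewrite (_ : mkset _ = \bigcap_(i in [set: 'I_k]) (@tnth _ T ^~ i @^-1` A (lift ord0 i))); last first.
  by apply/seteqP; split => x /= H i; [move=> _; exact: H|exact: H].
apply: fin_bigcap_measurable => // i _.
by rewrite -[X in measurable X]setTI; exact: measurable_tnth.
Qed.

End power_measure.

Section densities.
Context {R : realType}.

(** R^k is [k.-tuple R] with its product sigma-algebra, the Borel sets. *)
Definition lebesgue_measure_tuple k :
    {sigma_finite_measure set k.-tuple (measurableTypeR R) -> \bar R} :=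
  power_measure lebesgue_measure k.

Definition is_pdf d (T : measurableType d) (mu : {measure set T -> \bar R})
    (f : T -> R) :=
  [/\ measurable_fun setT f, forall x, 0 <= f x
    & (\int[mu]_x (f x)%:E = 1)%E].

Definition has_density d d' (Omega : measurableType d) (T : measurableType d')
    (P : probability Omega R) (mu : {measure set T -> \bar R})
    (X : {RV P >-> T}) (f : T -> R) :=
  forall B, measurable B ->
    (distribution P X B = \int[mu]_(x in B) (f x)%:E)%E.

Definition laplace_pdf (beta : R) (x : R) : R :=
  expR (- `|x| / beta) / (2 * beta).

End densities.

Section independence.
Context d (Omega : measurableType d) (R : realType) (P : probability Omega R).

Definition mutually_independent (I : choiceType)
    (F : I -> set_system Omega) :=
  forall (J : {fset I}) (E : I -> set Omega),
    (forall i, i \in J -> F i (E i)) ->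
    P (\bigcap_(i in [set` J]) E i) = (\prod_(i <- J) P (E i))%E.

Definition sigma_RV d' (T : measurableType d') (X : {RV P >-> T}) :
    set_system Omega :=
  preimage_set_system setT X measurable.

(** [None] is the threshold noise, [Some (inl n)] the n-th observation and
    [Some (inr n)] the n-th statistic noise. *)
Definition sigma_data_noise d' (T : measurableType d')
    (X : nat -> {RV P >-> T}) (Z : nat -> {RV P >-> measurableTypeR R})
    (W : {RV P >-> measurableTypeR R}) (i : option (nat + nat)) :
    set_system Omega :=
  match i with
  | None => sigma_RV W
  | Some (inl n) => sigma_RV (X n)
  | Some (inr n) => sigma_RV (Z n)
  end.

End independence.

Section cusum.
Context {R : realType}.
Local Open Scope ereal_scope.

(** Extended-real valued: the densities may vanish. With the library's
    conventions it is [+oo] where only [f0] vanishes and [-oo] where [f1]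
    vanishes; the set where both vanish is null under [f0] and [f1]. *)
Definition log_likelihood_ratio (V : Type) (f0 f1 : V -> R) (x : V) : \bar R :=
  lne ((f1 x)%:E / (f0 x)%:E).

(** [l n] is the log-likelihood ratio of the (n+1)-st observation: sequences
    indexed by t >= 1 are encoded with the index n = t - 1. *)
Fixpoint cusum (l : nat -> \bar R) (t : nat) : \bar R :=
  match t with
  | 0 => 0
  | n.+1 => maxe 0 (cusum l n) + l n
  end.

(** First t = n + 1 >= 1 with S_t + Z_t >= b + w, where [z n] stands for Z_t;
    [+oo] if there is none. *)
Definition dp_cusum_time (l : nat -> \bar R) (z : nat -> R) (w b : R) : \bar R :=
  ereal_inf [set (n.+1%:R)%:E | n in
    [set n | (b + w)%:E <= cusum l n.+1 + (z n)%:E]].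

Definition A_delta k (f0 f1 : k.-tuple (measurableTypeR R) -> R) (delta : R) :
    \bar R :=
  let pr f t := \int[lebesgue_measure_tuple k]_(x in
    [set x | t%:E <= 2%:E * `|log_likelihood_ratio f0 f1 x|]) (f x)%:E in
  ereal_inf [set t%:E | t in
    [set t : R | maxe (pr f0 t) (pr f1 t) <= (delta / 2)%:E]].

End cusum.

(* Main.v *)
Require Import Defs.
From HB Require Import structures.
From mathcomp Require Import all_boot all_order all_algebra.
From mathcomp Require Import finmap lra ring.
From mathcomp Require Import all_classical all_reals all_analysis.
From mathcomp Require Import measurable_realfun.

(** Why the bound holds.

    False alarms are controlled one time at a time. If every alarm event
    [b + W <= S_t + Z_t] has probability at most [q], the union bound gives
    [P (T >= N) >= 1 - (N - 1) q], so that [E T] is at least of order [1 / q]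
    ([expectation_first_time_ge]). It remains to bound [q] uniformly in [t].

    The likelihood ratio has mean at most 1 under [f0]
    ([expeR_llr_le]). By induction on [t], conditioning on the last
    observation, [P (S_t >= s) <= exp (- s)] for all [t] and [s]
    ([cusum_tail]): the tail of [max (0, S_t)] obeys the same bound, and adding
    an independent variable [V] to a variable [Y] whose tail is at most
    [K exp (- g s)] multiplies [K] by at most [E exp (g V)] ([tailD]).

    The same rule [tailD] then absorbs the two Laplace noises. The exponent
    must be lowered from 1 to some [g <= 1], which is harmless
    ([cusum_tail_rate]), and [g] must be below the inverse [1 / beta] of the
    noise scale [beta = 2 A / epsilon] for the moments to exist:
    [E exp (g |Z|) = 1 / (1 - g beta)] ([integral_exp_laplace]). With
    [h = min (1 / beta, 1)], the choice [g = h b / (b + 1)] keeps each moment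
    below [b + 1], while [exp (- g b) <= e exp (- h b)]. Hence
    [q <= (b + 1)^2 exp (1 - h b)], which is more than enough.

    The measure-theoretic substance is that the hypothesis of independence
    speaks of the sigma-algebras of the individual variables, whereas the
    induction needs the CUSUM statistic, a function of many observations, to be
    independent of the next variable. This is carried through the recursion by
    the invariant [indep_off], with uniqueness of product measures
    ([joint_law_on_event]) in the role of the monotone class argument. *)

Set Implicit Arguments.
Unset Strict Implicit.
Unset Printing Implicit Defensive.

Import Order.TTheory GRing.Theory Num.Theory.
Import numFieldNormedType.Exports.

Local Open Scope classical_set_scope.
Local Open Scope ring_scope.

(** * Measurability of functions on the extended reals *)

Section ereal_functions.
Context {R : realType}.
Local Open Scope ereal_scope.

(** The two infinities are measurable points, so measurability is decided on the
    finite part. *)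
Lemma emeasurable_fun_EFin (f : \bar R -> \bar R) (g : R -> \bar R) :
  measurable_fun setT g -> (forall r, f r%:E = g r) -> measurable_fun setT f.
Proof.
move=> mg fg.
rewrite (_ : f = fun x => if x == +oo then f +oo else
                          if x == -oo then f -oo else g (fine x)); last first.
  by apply/funext => -[r| |] //=.
apply: measurable_fun_ifT => //.
  by apply: measurable_fun_eqe.
apply: measurable_fun_ifT => //.
  by apply: measurable_fun_eqe.
apply: measurableT_comp => //; exact: fine_measurable.
Qed.

Lemma measurable_expeR : measurable_fun setT (@expeR R).
Proof.
apply: (@emeasurable_fun_EFin _ (EFin \o expR)) => //.
by apply/measurable_EFinP.
Qed.

Lemma measurable_lne : measurable_fun setT (@lne R).
Proof.
apply: (@emeasurable_fun_EFin _ (fun r => if (r <= 0)%R then -oo else (ln r)%:E)) => //.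
apply: measurable_fun_ifT => //.
  exact: measurable_fun_ler.
by apply/measurable_EFinP; exact: measurable_ln.
Qed.

Lemma measurable_inve : measurable_fun setT (@inve R).
Proof.
apply: (@emeasurable_fun_EFin _ (fun r => if r == 0%R then +oo else (r^-1)%:E)) => //.
apply: measurable_fun_ifT => //.
  exact: measurable_fun_eqr.
(* [r `^ (-1)] is the inverse for [r >= 0] only. *)
rewrite (_ : (fun r : R => _) =
    (fun r : R => if (0 <= r)%R then (r `^ (-1))%:E else (- (- r) `^ (-1))%:E)).
  apply: measurable_fun_ifT; first exact: measurable_fun_ler.
    by apply/measurable_EFinP; exact: measurable_powR.
  apply/measurable_EFinP; apply: measurableT_comp => //.
  pose pV : measurableTypeR R -> measurableTypeR R := fun x => (x `^ (-1))%R.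
  pose op : measurableTypeR R -> measurableTypeR R := -%R.
  have mpV : measurable_fun setT pV by exact: measurable_powR.
  have mop : measurable_fun setT op by exact: oppr_measurable.
  exact: (measurableT_comp mpV mop).
apply/funext => r; case: ifPn => r0; first by rewrite powR_inv1.
by rewrite powR_inv1 ?invrN ?opprK// oppr_ge0 ltW// ltNge.
Qed.

End ereal_functions.

(** * Joint laws and tails of sums of independent variables *)

Section joint_law.
Context d d1 d2 (Omega : measurableType d) (T1 : measurableType d1)
  (T2 : measurableType d2) (R : realType) (P : probability Omega R).
Local Open Scope ereal_scope.

(** Independence on rectangles, jointly with an event [F], extends to all
    measurable sets of pairs: conditionally on [F] the pair has the product
    measure as its law, by uniqueness of the product measure. *)
Lemma joint_law_on_event (U : {mfun Omega >-> T1}) (V : {mfun Omega >-> T2})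
    (F : set Omega) : measurable F ->
  (forall B C, measurable B -> measurable C ->
    P (U @^-1` B `&` V @^-1` C `&` F) = P (U @^-1` B) * P (V @^-1` C) * P F) ->
  forall D, measurable D ->
  P ((fun w => (U w, V w)) @^-1` D `&` F)
  = (distribution P U \x distribution P V) D * P F.
Proof.
move=> mF UVF D mD.
have mUV : measurable_fun setT (fun w => (U w, V w)).
  by apply: measurable_fun_pair; exact: measurable_funP.
have mE : measurable ((fun w => (U w, V w)) @^-1` D).
  by rewrite -[X in measurable X]setTI; exact: mUV.
have [PF0|PF0] := eqVneq (P F) 0.
  rewrite PF0 mule0; apply/eqP; rewrite -measure_le0 -PF0.
  by apply: le_measure; rewrite ?inE//; exact: measurableI.
have PFfin : P F \is a fin_num by exact: fin_num_measure.
have PFgt0 : (0 < fine (P F))%R.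
  by rewrite fine_gt0// lt0e PF0 measure_ge0/= ltey_eq PFfin.
have PFi0 : (0 <= (fine (P F))^-1)%R by rewrite invr_ge0 ltW.
pose UV w := (U w, V w).
(* The law of the pair conditioned on [F], a measure on the product space. *)
pose m' : {measure set (T1 * T2)%type -> \bar R} :=
  mscale (NngNum PFi0) (pushforward (mrestr P mF) UV).
have -> : (distribution P U \x distribution P V) D = m' mUV D.
  apply: product_measure_unique => // B C mB mC.
  transitivity ((fine (P F))^-1%:E * P (U @^-1` B `&` V @^-1` C `&` F)) => //.
  rewrite UVF// muleC -[X in _ * X * _](fineK PFfin) -muleA -EFinM mulfV ?gt_eqF//.
  by rewrite mule1.
rewrite [m' mUV D](_ : _ =
  (fine (P F))^-1%:E * P ((fun w => (U w, V w)) @^-1` D `&` F))//.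
rewrite muleAC -[X in _ * X * _](fineK PFfin) -EFinM mulVf ?gt_eqF//.
by rewrite mul1e.
Qed.

End joint_law.

Lemma bigcap_fset1U (I : choiceType) (T : Type) (i : I) (J : {fset I})
    (A : set T) (E : I -> set T) : (i \notin J)%fset ->
  \bigcap_(j in [set` (i |` J)%fset]) (if j == i then A else E j) =
  A `&` \bigcap_(j in [set` J]) E j.
Proof.
move=> iJ; apply/seteqP; split => w.
  move=> H; split; first by have := H i; rewrite /= eqxx fset1U1; exact.
  move=> j jJ; have := H j; rewrite /= in_fset1U jJ orbT => /(_ isT).
  by case: eqP => // ji; rewrite -ji jJ in iJ.
move=> [Aw Ew] j /=; rewrite in_fset1U; case: eqP => //= _ jJ; exact: Ew.
Qed.

Section independent_steps.
Context d (Omega : measurableType d) (R : realType) (P : probability Omega R).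
Context (I : choiceType) (F : I -> set_system Omega).
Context (mF : forall i A, F i A -> measurable A).
Context (indepF : mutually_independent P F).
Local Open Scope ereal_scope.

Lemma indep_event_inter (i : I) (J : {fset I}) (A : set Omega)
    (E : I -> set Omega) :
  (i \notin J)%fset -> F i A -> (forall j, j \in J -> F j (E j)) ->
  P (A `&` \bigcap_(j in [set` J]) E j) =
  P A * P (\bigcap_(j in [set` J]) E j).
Proof.
move=> iJ FA FE; rewrite -(bigcap_fset1U A E iJ) indepF; last first.
  by move=> j; rewrite in_fset1U; case: eqP => [->|_] //= /FE.
rewrite big_fsetU1//= eqxx indepF//; congr (_ * _).
by apply: eq_big_seq => j jJ; case: eqP => // ji; rewrite -ji jJ in iJ.
Qed.

Lemma measurable_bigcap_events (J : {fset I}) (E : I -> set Omega) :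
  (forall j, j \in J -> F j (E j)) ->
  measurable (\bigcap_(j in [set` J]) E j).
Proof.
move=> FE; apply: fin_bigcap_measurable; first exact: finite_fset.
by move=> j jJ; apply: mF; exact: FE.
Qed.

(** [Q] collects the indices on which [Y] may depend; [Y] is asked to be
    independent of all the other sigma-algebras jointly, which is what survives
    when a further index is consumed. *)
Definition indep_off (Q : pred I) (Y : Omega -> \bar R) :=
  forall (J : {fset I}) (E : I -> set Omega) (B : set (\bar R)),
    (forall j, j \in J -> ~~ Q j /\ F j (E j)) -> measurable B ->
    P (Y @^-1` B `&` \bigcap_(j in [set` J]) E j) =
    P (Y @^-1` B) * P (\bigcap_(j in [set` J]) E j).

Definition generated_at (i : I) (V : Omega -> \bar R) :=
  forall C, measurable C -> F i (V @^-1` C).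

Lemma indep_off_cst c : indep_off pred0 (cst c).
Proof.
move=> J E B _ mB; rewrite preimage_cst; case: ifPn => _.
  by rewrite setTI probability_setT mul1e.
by rewrite set0I measure0 mul0e.
Qed.

Lemma indep_off_sub (Q Q' : pred I) Y : {subset Q <= Q'} ->
  indep_off Q Y -> indep_off Q' Y.
Proof.
move=> QQ' QY J E B FE mB; apply: QY => // j /FE[Q'j]; split => //.
by apply: contra Q'j; exact: QQ'.
Qed.

Lemma indep_off_comp Q Y (f : \bar R -> \bar R) : measurable_fun setT f ->
  indep_off Q Y -> indep_off Q (f \o Y).
Proof.
move=> mf QY J E B FE mB; apply: (QY J E (f @^-1` B) FE).
by rewrite -[X in measurable X]setTI; exact: mf.
Qed.

Lemma indep_off_rectangle Q i (Y V : Omega -> \bar R) (J : {fset I}) E B C :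
  indep_off Q Y -> ~~ Q i -> generated_at i V ->
  (forall j, j \in J -> ~~ predU1 i Q j /\ F j (E j)) ->
  measurable B -> measurable C ->
  P (V @^-1` B `&` Y @^-1` C `&` \bigcap_(j in [set` J]) E j) =
  P (V @^-1` B) * P (Y @^-1` C) * P (\bigcap_(j in [set` J]) E j).
Proof.
move=> QY Qi iV FE mB mC.
have iJ : (i \notin J)%fset by apply/negP => /FE[]; rewrite /= eqxx.
(* Seen from [Y], the event of [V] is one more event outside [Q]. *)
rewrite setIAC setIC -(bigcap_fset1U (V @^-1` B) E iJ) QY//; last first.
  move=> j; rewrite in_fset1U; case: eqP => [->|_] /= => [_|/FE[/norP[]]//].
  by split => //; exact: iV.
rewrite bigcap_fset1U// (@indep_event_inter i)//.
- by rewrite muleCA muleA.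
- exact: iV.
- by move=> j /FE[].
Qed.

Lemma joint_law_indep_off Q i (Y V : {mfun Omega >-> \bar R}) D :
  indep_off Q Y -> ~~ Q i -> generated_at i V -> measurable D ->
  P ((fun w => (V w, Y w)) @^-1` D) =
  (distribution P V \x distribution P Y) D.
Proof.
move=> QY Qi iV mD; rewrite -[in LHS](setIT (_ @^-1` _)).
rewrite (joint_law_on_event measurableT)// => [|B C mB mC].
  by rewrite probability_setT mule1.
have := @indep_off_rectangle Q i Y V fset0 (fun=> setT) B C QY Qi iV.
by rewrite set_fset0 bigcap_set0; exact.
Qed.

(** One step of a recursion driven by fresh independent inputs. *)
Lemma indep_off_step Q i (Y V : Omega -> \bar R)
    (g : \bar R * \bar R -> \bar R) :
  measurable_fun setT Y -> measurable_fun setT V -> measurable_fun setT g ->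
  indep_off Q Y -> ~~ Q i -> generated_at i V ->
  indep_off (predU1 i Q) (fun w => g (V w, Y w)).
Proof.
move=> mY mV mg QY Qi iV J E B FE mB.
pose Y' : {mfun Omega >-> \bar R} := HB.pack Y (isMeasurableFun.Build _ _ _ _ Y mY).
pose V' : {mfun Omega >-> \bar R} := HB.pack V (isMeasurableFun.Build _ _ _ _ V mV).
have mD : measurable (g @^-1` B) by rewrite -[X in measurable X]setTI; exact: mg.
have mJ : measurable (\bigcap_(j in [set` J]) E j).
  by apply: measurable_bigcap_events => j /FE[].
have -> : (fun w => g (V w, Y w)) @^-1` B = (fun w => (V' w, Y' w)) @^-1` (g @^-1` B).
  by [].
rewrite (joint_law_on_event mJ)//; last first.
  by move=> B' C' mB' mC'; exact: (indep_off_rectangle QY Qi iV).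
by rewrite (joint_law_indep_off (Y := Y') (V := V') QY Qi iV mD).
Qed.

(** Condition on [V = v]: the tail of [Y] at [s - v] is at most
    [K exp (- h s) exp (h v)], and integrating over the law of [V] gives the
    exponential moment. *)
Lemma tailD Q i (Y V : Omega -> \bar R) (h K M : R) :
  measurable_fun setT Y -> measurable_fun setT V ->
  indep_off Q Y -> ~~ Q i -> generated_at i V ->
  (0 < h)%R -> (0 < K)%R ->
  (forall s : R, P [set w | s%:E <= Y w] <= (K * expR (- (h * s)))%:E) ->
  \int[P]_w expeR (h%:E * V w) <= M%:E ->
  forall s : R,
    P [set w | s%:E <= Y w + V w] <= (K * M * expR (- (h * s)))%:E.
Proof.
move=> mY mV QY Qi iV h0 K0 tY EV s.
pose Y' : {mfun Omega >-> \bar R} := HB.pack Y (isMeasurableFun.Build _ _ _ _ Y mY).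
pose V' : {mfun Omega >-> \bar R} := HB.pack V (isMeasurableFun.Build _ _ _ _ V mV).
pose D := [set p : \bar R * \bar R | s%:E <= p.2 + p.1].
have mD : measurable D.
  rewrite -[X in measurable X]setTI; apply: measurable_lee => //.
  exact: emeasurable_funD.
have -> : [set w | s%:E <= Y w + V w] = (fun w => (V' w, Y' w)) @^-1` D by [].
rewrite (joint_law_indep_off (Y := Y') (V := V') QY Qi iV mD).
rewrite /product_measure1.
have mexp : measurable_fun setT (fun v : \bar R => expeR (h%:E * v)).
  by apply: (measurableT_comp measurable_expeR); exact: measurable_funeM.
apply: (@le_trans _ _ (\int[distribution P V']_v
   ((K * expR (- (h * s)))%:E * expeR (h%:E * v)))).
  apply: ge0_le_integral => //.
  - exact: measurable_fun_xsection.
  - by apply: emeasurable_funM.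
  move=> v _ /=.
  have -> : xsection D v = [set y | s%:E <= y + v].
    by apply/seteqP; split => y; rewrite /xsection/= inE.
  rewrite /distribution /pushforward.
  (* At [v = +oo] the bound is infinite because [K > 0]; at [v = -oo] the sum
     is [-oo], whatever [Y] is. *)
  case: v => [v| |].
  - rewrite /= -EFinM -mulrA -expRD.
    have -> : (- (h * s) + h * v)%R = (- (h * (s - v)))%R.
      by rewrite mulrBr opprB addrC.
    apply: le_trans (tY _); apply: le_measure; rewrite ?inE//.
    + by rewrite -[X in measurable X]setTI; apply: measurable_lee => //;
        exact: emeasurable_funD.
    + by rewrite -[X in measurable X]setTI; apply: measurable_lee.
    by move=> w /=; rewrite EFinB leeBlDr.
  - rewrite gt0_muley ?lte_fin// /= gt0_muley ?leey// lte_fin.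
    by rewrite mulr_gt0// expR_gt0.
  - rewrite gt0_muleNy ?lte_fin// /= mule0.
    rewrite (_ : _ @^-1` _ = set0) ?measure0//.
    by apply/seteqP; split => w //=; rewrite addeNy.
rewrite ge0_integralZl//; last 2 first.
  by move=> v _; exact: expeR_ge0.
  by rewrite lee_fin mulr_ge0 ?expR_ge0// ltW.
rewrite ge0_integral_distribution//; last by move=> v; exact: expeR_ge0.
rewrite [X in _ <= X](_ : _ = (K * expR (- (h * s)))%:E * M%:E); last first.
  by rewrite -EFinM mulrAC.
by rewrite lee_wpmul2l// lee_fin mulr_ge0 ?expR_ge0// ltW.
Qed.

End independent_steps.

(** * Mean of the first time at which an unlikely event occurs *)

Section first_time.
Context d (Omega : measurableType d) (R : realType) (P : probability Omega R).
Local Open Scope ereal_scope.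
Import HBNNSimple.

(** Markov's inequality for a function that need not be measurable: the step
    function below it is simple. *)
Lemma le_integral_step (f : Omega -> \bar R) (A : set Omega) (c : R) :
  measurable A -> (0 <= c)%R -> (forall w, 0 <= f w) ->
  (forall w, A w -> c%:E <= f w) -> c%:E * P A <= \int[P]_w f w.
Proof.
move=> mA c0 f0 cf; rewrite ge0_integralTE//; apply: ereal_sup_ubound => /=.
exists (scale_nnsfun (indic_nnsfun R mA) c0).
  move=> w /=; rewrite /mindic indicE.
  have [|_] := boolP (w \in A); first by rewrite inE mulr1; exact: cf.
  by rewrite mulr0.
transitivity (sintegral P (cst c \* indic_nnsfun R mA)%R).
  by apply: eq_sintegral => w.
rewrite -(sintegral_indic P A); exact: sintegralrM.
Qed.

(** With [N] the integer part of [2 tau], the union bound shows that no event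
    occurs among the first [N] with probability at least 1/2, and then the first
    time is at least [N + 1 >= 2 tau]. *)
Lemma expectation_first_time_ge (A : nat -> set Omega) (q tau : R) :
  (forall n, measurable (A n)) -> (forall n, P (A n) <= q%:E) ->
  (0 < tau)%R -> (4 * tau * q <= 1)%R ->
  tau%:E <= \int[P]_w ereal_inf [set (n.+1%:R)%:E | n in [set n | A n w]].
Proof.
move=> mA PA tau0 tauq.
have q0 : (0 <= q)%R by rewrite -lee_fin (le_trans _ (PA 0%N)).
have tau20 : (0 <= 2 * tau)%R by rewrite mulr_ge0// ltW.
pose N := Num.truncn (2 * tau)%R.
have /andP[N2 N3] := truncn_itv tau20.
pose U := \big[setU/set0]_(n < N) A n.
have mU : measurable U by exact: bigsetU_measurable.
have PU : P U <= (2^-1)%:E.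
  have UA : P U <= \sum_(i < N) P (A i) by apply: Boole_inequality => i _.
  apply: (le_trans UA).
  apply: (@le_trans _ _ (\sum_(i < N) q%:E)); first exact: lee_sum.
  rewrite sumEFin sumr_const card_ord lee_fin -[(q *+ N)%R]mulr_natr.
  by apply: (@le_trans _ _ (q * (2 * tau))%R); [exact: ler_wpM2l|lra].
apply: (@le_trans _ _ ((N.+1%:R)%:E * P (~` U))).
  rewrite probability_setC//.
  apply: (@le_trans _ _ ((2 * tau)%:E * (2^-1)%:E)).
    by rewrite -EFinM lee_fin mulrAC mulfV// mul1r.
  apply: lee_pmul => //; rewrite ?lee_fin ?invr_ge0//; first exact: ltW.
  rewrite leeBrDr ?fin_num_measure//.
  apply: (le_trans (leeD2l _ PU)).
  by rewrite -EFinD lee_fin; lra.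
apply: le_integral_step => //.
- exact: measurableC.
- by move=> w; apply: le_ereal_inf_tmp => _ [n _ <-]; rewrite lee_fin.
move=> w Uw; apply: le_ereal_inf_tmp => _ [n /= Anw <-].
rewrite lee_fin ler_nat ltnS leqNgt; apply/negP => nN; apply: Uw.
rewrite /U -bigcup_mkord; exists n => //.
Qed.

End first_time.

(** * Integration against a density *)

Section density_integrals.
Local Open Scope ereal_scope.

(** The density is almost everywhere the Radon-Nikodym derivative of the law,
    to which the change of variables applies. *)
Lemma integral_has_density d d' (Omega : measurableType d)
    (T : measurableType d') (R : realType) (P : probability Omega R)
    (mu : {sigma_finite_measure set T -> \bar R}) (X : {RV P >-> T})
    (f : T -> R) (g : T -> \bar R) :
  is_pdf mu f -> has_density mu X f ->
  measurable_fun setT g -> (forall x, 0 <= g x) ->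
  \int[P]_w g (X w) = \int[mu]_x (g x * (f x)%:E).
Proof.
move=> [mf f0 f1] Xf mg g0.
have mEf : measurable_fun setT (EFin \o f) by exact/measurable_EFinP.
have dom : distribution P X `<< mu.
  apply/null_content_dominatesP => B mB muB0; rewrite [LHS]Xf//.
  by rewrite null_set_integral//; exact: measurable_funTS.
rewrite -ge0_integral_distribution//.
rewrite -(Radon_Nikodym_SigmaFinite.change_of_variables dom)//.
have RNf : ae_eq mu setT
    (Radon_Nikodym_SigmaFinite.f (distribution P X) mu) (EFin \o f).
  apply: integral_ae_eq => //.
    exact: Radon_Nikodym_SigmaFinite.f_integrable.
  by move=> B _ mB; rewrite -Radon_Nikodym_SigmaFinite.f_integral//; exact: Xf.
apply: ae_eq_integral => //.
- apply: emeasurable_funM => //.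
  by apply: (measurable_int mu); exact: Radon_Nikodym_SigmaFinite.f_integrable.
- exact: emeasurable_funM.
- case: RNf => N [mN N0 sub]; exists N; split => // x /= H.
  by apply: sub => /= K; apply: H => _; rewrite K.
Qed.

(** Multiplied by [exp (h |x|)], the Laplace density remains a two-sided
    exponential, of rate [1 / beta - h]. *)
Lemma integral_exp_laplace (R : realType) (beta h : R) :
  (0 < beta)%R -> (h * beta < 1)%R ->
  \int[lebesgue_measure]_x ((expR (h * `|x|))%:E * (laplace_pdf beta x)%:E)
  = ((1 - h * beta)^-1)%:E.
Proof.
move=> b0 hb1.
pose r : R := (beta^-1 - h)%R.
have r0 : (0 < r)%R by rewrite subr_gt0 -(ltr_pM2r b0) mulVf ?gt_eqF.
pose q (x : R) : R := (expR (- r * `|x|) / (2 * beta))%R.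
have -> : (fun x => (expR (h * `|x|))%:E * (laplace_pdf beta x)%:E) =
    (fun x => (q x)%:E).
  apply/funext => x; rewrite -EFinM /laplace_pdf mulrA -expRD.
  rewrite /q /r; congr (expR _ / _)%:E.
  by rewrite opprB mulrBl mulNr (mulrC _ (beta^-1)%R).
rewrite ge0_symfun_integralT; last 3 first.
- by move=> x; rewrite /q divr_ge0 ?expR_ge0// mulr_ge0// ltW.
- move=> x; rewrite /q; apply: cvgMl.
  apply: continuous_comp; last exact: continuous_expR.
  by apply: cvgMr; exact: norm_continuous.
- by move=> x; rewrite /q /= normrN.
have -> : \int[lebesgue_measure]_(x in [set x | (0 <= x)%R]) (q x)%:E =
    ((2 * beta * r)^-1)%:E * \int[lebesgue_measure]_x (exponential_pdf r x)%:E.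
  rewrite -ge0_integralZl//; last 3 first.
  - by apply/measurable_EFinP; exact: measurable_exponential_pdf.
  - by move=> x _; rewrite lee_fin exponential_pdf_ge0// ltW.
  - by rewrite lee_fin invr_ge0 !mulr_ge0// ltW.
  rewrite [LHS]integral_mkcond; apply: eq_integral => x _.
  rewrite patchE; case: ifPn; rewrite ?inE ?notin_setE /=.
    move=> x0; rewrite exponential_pdfE// /q ger0_norm// -EFinM; congr EFin.
    by set a := (2 * beta)%R; rewrite (invfM a) -[RHS]mulrA mulKf ?gt_eqF// mulrC.
  by move=> /negP; rewrite -ltNge => x0; rewrite lt0_exponential_pdf// mule0.
rewrite integral_exponential_pdf// mule1 -EFinM; congr EFin.
rewrite -mulrA invfM mulrA mulfV// mul1r /r mulrBr mulfV ?gt_eqF//.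
by rewrite (mulrC beta).
Qed.

End density_integrals.

(** * The tail of the CUSUM statistic *)

Definition observed (I : eqType) (idx : nat -> I) (t : nat) : pred I :=
  [pred i | [exists n : 'I_t, i == idx n]].

Section cusum_tail.
Context d (Omega : measurableType d) (R : realType) (P : probability Omega R).
Context (I : choiceType) (F : I -> set_system Omega).
Context (mF : forall i A, F i A -> measurable A).
Context (indepF : mutually_independent P F).
Context (L : nat -> Omega -> \bar R) (idx : nat -> I).
Context (idx_inj : injective idx).
Context (mL : forall n, measurable_fun setT (L n)).
Context (genL : forall n, generated_at F (idx n) (L n)).
Context (expL : forall n, (\int[P]_w expeR (L n w) <= 1)%E).
Local Open Scope ereal_scope.

Let S t w := cusum (L ^~ w) t.
Let used := observed idx.

Lemma measurable_cusum t : measurable_fun setT (S t).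
Proof.
elim: t => [|t IH]; first exact: measurable_cst.
by apply: emeasurable_funD => //; exact: measurable_maxe.
Qed.

Lemma indep_off_max0 Q Y : indep_off P F Q Y ->
  indep_off P F Q (fun w => maxe 0 (Y w)).
Proof.
by move=> QY; apply: (@indep_off_comp _ _ _ P I F Q Y (maxe 0)) => //;
  exact: measurable_maxe.
Qed.

Lemma fresh_idx t n : (t <= n)%N -> ~~ used t (idx n).
Proof.
move=> tn; apply/negP => /existsP[m /eqP/idx_inj nm].
by move: tn; rewrite nm leqNgt ltn_ord.
Qed.

Lemma indep_off_cusum t : indep_off P F (used t) (S t).
Proof.
elim: t => [|t IH].
  by apply: (@indep_off_sub _ _ _ P I F pred0) => //; exact: (@indep_off_cst _ _ _ P I F 0).
have step : indep_off P F (predU1 (idx t) (used t))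
    (fun w => maxe 0 (S t w) + L t w).
  apply: (@indep_off_step _ _ _ _ _ _ mF indepF (used t) (idx t)
    (fun w => maxe 0 (S t w)) (L t) (fun p => p.2 + p.1)).
  - by apply: measurable_maxe => //; exact: measurable_cusum.
  - exact: mL.
  - exact: emeasurable_funD.
  - exact: indep_off_max0.
  - exact: fresh_idx.
  - exact: genL.
apply: indep_off_sub step => i; rewrite !inE => /predU1P[->|].
  by apply/existsP; exists ord_max.
by move=> /existsP[m /eqP ->]; apply/existsP; exists (widen_ord (leqnSn t) m).
Qed.

(** Since [exp (- s) >= 1] for [s <= 0], reflecting at 0 does not spoil the
    bound, so that the recursion preserves it. *)
Lemma cusum_tail t (s : R) : P [set w | s%:E <= S t w] <= (expR (- s))%:E.
Proof.
elim: t s => [|t IH] s.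
  have [s0|s0] := ltP 0%R s.
    have -> : [set w | s%:E <= S 0 w] = set0.
      by apply/seteqP; split => w //=; rewrite lee_fin leNgt s0.
    by rewrite measure0 lee_fin expR_ge0.
  apply: (@le_trans _ _ 1); last by rewrite lee_fin -expR0 ler_expR oppr_ge0.
  rewrite probability_le1// -[X in measurable X]setTI.
  by apply: measurable_lee => //; exact: (measurable_cusum 0).
have tail0 (r : R) : P [set w | r%:E <= maxe 0 (S t w)] <= (1 * expR (- (1 * r)))%:E.
  rewrite !mul1r; have [r0|r0] := ltP 0%R r.
    suff -> : [set w | r%:E <= maxe 0 (S t w)] = [set w | r%:E <= S t w] by [].
    by apply/seteqP; split => w /=; rewrite le_max lee_fin (leNgt r 0%R) r0.
  apply: (@le_trans _ _ 1); last by rewrite lee_fin -expR0 ler_expR oppr_ge0.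
  rewrite probability_le1// -[X in measurable X]setTI.
  by apply: measurable_lee => //; apply: measurable_maxe => //; exact: measurable_cusum.
have -> : expR (- s) = (1 * 1 * expR (- (1 * s)))%R by rewrite !mul1r.
apply: (tailD (Q := used t) (i := idx t) indepF) => //.
- by apply: measurable_maxe => //; exact: measurable_cusum.
- by apply: indep_off_max0; exact: indep_off_cusum.
- exact: fresh_idx.
- by under eq_integral do rewrite mul1e; exact: expL.
Qed.

(** Probabilities are at most 1, so an exponential tail bound may be flattened:
    for [s <= 0] the right-hand side is at least 1. *)
Lemma cusum_tail_rate (h : R) t (s : R) : (0 <= h <= 1)%R ->
  P [set w | s%:E <= S t w] <= (expR (- (h * s)))%:E.
Proof.
move=> /andP[h0 h1]; have [s0|s0] := ltP 0%R s.
  apply: (le_trans (cusum_tail t s)).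
  by rewrite lee_fin ler_expR lerN2 ler_piMl// ltW.
apply: (@le_trans _ _ 1).
  rewrite probability_le1// -[X in measurable X]setTI.
  by apply: measurable_lee => //; exact: measurable_cusum.
by rewrite lee_fin -expR0 ler_expR oppr_ge0 mulr_ge0_le0.
Qed.

End cusum_tail.

(** * The likelihood ratio *)

Section likelihood_ratio.
Context (R : realType) d (V : measurableType d) (f0 f1 : V -> R).
Context (f0_ge0 : forall x, 0 <= f0 x).
Context (f1_ge0 : forall x, 0 <= f1 x).
Local Open Scope ereal_scope.

Lemma measurable_log_likelihood_ratio :
  measurable_fun setT f0 -> measurable_fun setT f1 ->
  measurable_fun setT (log_likelihood_ratio f0 f1).
Proof.
move=> mf0 mf1; apply: (measurableT_comp measurable_lne).
apply: emeasurable_funM; first exact/measurable_EFinP.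
by apply: (measurableT_comp measurable_inve); exact/measurable_EFinP.
Qed.

(** Only an inequality: [f1] may charge the zeros of [f0], where the ratio is
    infinite but the left-hand side vanishes. *)
Lemma expeR_llr_le x :
  expeR (log_likelihood_ratio f0 f1 x) * (f0 x)%:E <= (f1 x)%:E.
Proof.
have [f00|f00] := eqVneq (f0 x) 0%R.
  by rewrite f00 mule0 lee_fin.
rewrite /log_likelihood_ratio inver (negbTE f00) -EFinM lneK.
  by rewrite -EFinM divfK.
by rewrite in_itv/= leey lee_fin divr_ge0.
Qed.

End likelihood_ratio.

(** * Moments of the Laplace noise *)

Lemma is_pdf_laplace (R : realType) (beta : R) : 0 < beta ->
  is_pdf lebesgue_measure (laplace_pdf beta : measurableTypeR R -> R).
Proof.
move=> b0; split.
- apply: measurable_funM => //.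
  apply: (measurableT_comp (@measurable_expR _)).
  apply: measurable_funM => //.
  apply: measurable_funN; exact: normr_measurable.
- by move=> x; rewrite /laplace_pdf divr_ge0 ?expR_ge0// mulr_ge0// ltW.
have := @integral_exp_laplace R beta 0 b0.
rewrite mul0r subr0 invr1 => /(_ ltr01) <-.
by apply: eq_integral => x _; rewrite mul0r expR0 mul1e.
Qed.

Section noise.
Context d (Omega : measurableType d) (R : realType) (P : probability Omega R).
Local Open Scope ereal_scope.

(** [Y] stands for [N] or [- N], the two signs with which noise enters. *)
Lemma exp_moment_laplace (beta h : R) (N : {RV P >-> measurableTypeR R})
    (Y : Omega -> R) :
  (0 < beta)%R -> (0 <= h)%R -> (h * beta < 1)%R ->
  has_density lebesgue_measure N (laplace_pdf beta) ->
  measurable_fun setT Y -> (forall w, `|Y w| = `|N w|)%R ->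
  \int[P]_w expeR (h%:E * (Y w)%:E) <= ((1 - h * beta)^-1)%:E.
Proof.
move=> b0 h0 hb ND mY YN.
rewrite -integral_exp_laplace//.
have mg : measurable_fun setT (fun z : measurableTypeR R => (expR (h * `|z|))%:E).
  apply/measurable_EFinP; apply: (measurableT_comp (@measurable_expR _)).
  by apply: measurable_funM => //; exact: normr_measurable.
have g0 (z : R) : 0 <= (expR (h * `|z|))%:E by rewrite lee_fin expR_ge0.
rewrite -(integral_has_density (is_pdf_laplace b0) ND mg g0).
apply: ge0_le_integral => //.
- by move=> w _; exact: expeR_ge0.
- apply: (measurableT_comp measurable_expeR); apply: measurable_funeM.
  exact/measurable_EFinP.
- by apply: (measurableT_comp mg).
by move=> w _; rewrite -EFinM /= lee_fin ler_expR -YN ler_wpM2l// ler_norm.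
Qed.

End noise.

(** * The lower bound on the mean time to a false alarm *)

Theorem corollary1 (R : realType) (k : nat)
    (f0 f1 : k.-tuple (measurableTypeR R) -> R)
    (pdf0 : is_pdf (lebesgue_measure_tuple k) f0)
    (pdf1 : is_pdf (lebesgue_measure_tuple k) f1)
    (neq01 : f0 <> f1)
    (epsilon delta b : R)
    (epsilon_gt0 : 0 < epsilon) (delta_gt0 : 0 < delta) (delta_lt1 : delta < 1)
    (b_gt2 : 2 < b)
    (A : R) (AE : A_delta f0 f1 delta = A%:E) (A_gt0 : 0 < A)
    (d : measure_display) (Omega : measurableType d) (P : probability Omega R)
    (X : nat -> {RV P >-> k.-tuple (measurableTypeR R)})
    (Z : nat -> {RV P >-> measurableTypeR R})
    (W : {RV P >-> measurableTypeR R})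
    (X_density : forall n, has_density (lebesgue_measure_tuple k) (X n) f0)
    (Z_density : forall n,
      has_density lebesgue_measure (Z n) (laplace_pdf (2 * A / epsilon)))
    (W_density : has_density lebesgue_measure W (laplace_pdf (2 * A / epsilon)))
    (indep : mutually_independent P (sigma_data_noise X Z W)) :
  ((expR (Num.min (epsilon / (2 * A)) 1 * b - 2) / (4 * (b + 1) ^+ 2))%:E
   <= \int[P]_w dp_cusum_time
        (fun n => log_likelihood_ratio f0 f1 (X n w))
        (fun n => Z n w) (W w) b)%E.
Proof.
have [mf0 f0_ge0 int_f0] := pdf0.
have [mf1 f1_ge0 int_f1] := pdf1.
set beta := 2 * A / epsilon in Z_density W_density *.
have beta_gt0 : 0 < beta by rewrite divr_gt0// mulr_gt0.
have -> : epsilon / (2 * A) = beta^-1 by rewrite /beta invf_div.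
set h := Num.min beta^-1 1.
have h_gt0 : 0 < h by rewrite lt_min invr_gt0 beta_gt0 ltr01.
have h_le1 : h <= 1 by rewrite ge_min lexx orbT.
have hbeta : h * beta <= 1 by rewrite -ler_pdivlMr// div1r ge_min lexx.
have b0 : 0 < b by lra.
have b10 : 0 < b + 1 by lra.
(* [g < h] leaves room for the moments of order [g] of the noise; the factor
   [u] keeps these below [b + 1] and the loss [exp ((h - g) b)] below [e]. *)
pose u := b / (b + 1).
have u_gt0 : 0 < u by rewrite divr_gt0.
have u_lt1 : u < 1 by rewrite ltr_pdivrMr//; lra.
pose g := h * u.
have g_gt0 : 0 < g by rewrite mulr_gt0.
have g_le1 : g <= 1 by rewrite mulr_ile1// ltW.
have gbeta : g * beta <= u by rewrite /g mulrAC ler_piMl// ltW.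
have gbeta_lt1 : g * beta < 1 by exact: le_lt_trans u_lt1.
pose M := (1 - g * beta)^-1.
have M_gt0 : 0 < M by rewrite invr_gt0 subr_gt0.
have M_le : M <= b + 1.
  rewrite -[leRHS]invrK lef_pV2 ?posrE ?subr_gt0 ?invr_gt0//.
  rewrite lerBrDr -lerBrDl (le_trans gbeta)//.
  by rewrite /u -{1}[b](addrK 1) mulrBl divff ?gt_eqF// mul1r.
pose F := sigma_data_noise X Z W.
pose idx n : option (nat + nat) := Some (inl n).
have mF i E : F i E -> measurable E.
  case: i => [[n|n]|] [B mB <-]; rewrite setTI -[X in measurable X]setTI;
    by apply: (measurable_funP _).
pose L n w := log_likelihood_ratio f0 f1 (X n w).
have mllr := measurable_log_likelihood_ratio mf0 mf1.
have mL n : measurable_fun setT (L n) by exact: (measurableT_comp mllr).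
have genL n : generated_at F (idx n) (L n).
  move=> C mC; exists (log_likelihood_ratio f0 f1 @^-1` C); last by rewrite setTI.
  by rewrite -[X in measurable X]setTI; exact: mllr.
have idx_inj : injective idx by move=> m n [].
have expL n : (\int[P]_w expeR (L n w) <= 1)%E.
  rewrite (integral_has_density pdf0 (X_density n)
    (g := fun x => expeR (log_likelihood_ratio f0 f1 x))); last 2 first.
  - exact: (measurableT_comp measurable_expeR).
  - by move=> x; exact: expeR_ge0.
  rewrite -int_f1; apply: ge0_le_integral => //.
  - by move=> x _; rewrite mule_ge0 ?expeR_ge0// lee_fin.
  - apply: emeasurable_funM; first exact: (measurableT_comp measurable_expeR).
    exact/measurable_EFinP.
  - exact/measurable_EFinP.
  - by move=> x _; exact: expeR_llr_le.
have mZ n : measurable_fun setT (fun w => (Z n w)%:E).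
  by apply/measurable_EFinP; exact: (measurable_funP (Z n)).
have mNW : measurable_fun setT (fun w => - (W w) : R).
  by apply: measurable_funN; exact: (measurable_funP W).
have mNWE : measurable_fun setT (fun w => (- (W w : R))%:E).
  exact/measurable_EFinP.
have genZ n : generated_at F (Some (inr n)) (fun w => (Z n w)%:E).
  move=> C mC; exists (EFin @^-1` C); last by rewrite setTI.
  rewrite -[X in measurable X]setTI.
  have : measurable_fun setT (EFin : measurableTypeR R -> _) by exact/measurable_EFinP.
  exact.
have genW : generated_at F None (fun w => (- (W w : R))%:E).
  move=> C mC; exists ((fun x : measurableTypeR R => (- x)%:E) @^-1` C); last by rewrite setTI.
  rewrite -[X in measurable X]setTI.
  have : measurable_fun setT (fun x : measurableTypeR R => (- x)%:E).
    by apply/measurable_EFinP; exact: oppr_measurable.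
  exact.
pose S n w := cusum (L ^~ w) n.+1.
have mS n : measurable_fun setT (S n) by exact: measurable_cusum.
have mSZ n : measurable_fun setT (fun w => S n w + (Z n w)%:E)%E.
  exact: emeasurable_funD.
have tailSZ n s :
    (P [set w | s%:E <= S n w + (Z n w)%:E] <= (1 * M * expR (- (g * s)))%:E)%E.
  apply: (tailD indep (Q := observed idx n.+1) (i := Some (inr n))) => //.
  - exact: indep_off_cusum.
  - by apply/negP => /existsP[].
  - by move=> r; rewrite mul1r; apply: (cusum_tail_rate mF indep idx_inj mL genL expL);
      rewrite (ltW g_gt0).
  - apply: (exp_moment_laplace beta_gt0 (ltW g_gt0) gbeta_lt1 (Z_density n)) => //.
    exact: (measurable_funP (Z n)).
pose alarm n := [set w | ((b + W w)%:E <= S n w + (Z n w)%:E)%E].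
have P_alarm n : (P (alarm n) <= (1 * M * M * expR (- (g * b)))%:E)%E.
  have -> : alarm n = [set w | b%:E <= S n w + (Z n w)%:E + (- (W w : R))%:E]%E.
    by apply/seteqP; split => w /=; rewrite EFinN leeBrDr.
  apply: (tailD indep (Q := predU1 (Some (inr n)) (observed idx n.+1)) (i := None)) => //.
  - apply: (indep_off_step mF indep (Y := S n) (V := fun w => (Z n w)%:E)
      (g := fun p => (p.2 + p.1)%E)) => //.
    + exact: emeasurable_funD.
    + exact: (indep_off_cusum mF indep).
    + by apply/negP => /existsP[].
  - by rewrite inE/=; apply/negP => /existsP[].
  - by rewrite mul1r.
  - apply: (exp_moment_laplace beta_gt0 (ltW g_gt0) gbeta_lt1 W_density) => //.
    by move=> w; rewrite normrN.
apply: (@expectation_first_time_ge _ _ _ P alarm (M * M * expR (- (g * b)))).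
- move=> n; rewrite -[X in measurable X]setTI; apply: measurable_lee => //.
  by apply/measurable_EFinP; apply: measurable_funD => //; exact: (measurable_funP W).
- by move=> n; rewrite (le_trans (P_alarm n))// mul1r.
- by rewrite divr_gt0 ?expR_gt0// mulr_gt0// exprn_gt0.
have gap : h * b - 2 + - (g * b) <= 0.
  have ub : b - u * b = u by rewrite -{1}(divfK (lt0r_neq0 b10) b) -/u
    mulrDr mulr1 addrAC subrr add0r.
  have : h * (b - u * b) <= 1 by rewrite ub.
  by rewrite mulrBr mulrA -/g; lra.
have MM : M * M <= (b + 1) ^+ 2 by rewrite expr2 ler_pM// ltW.
have -> : 4 * (expR (h * b - 2) / (4 * (b + 1) ^+ 2)) * (M * M * expR (- (g * b)))
   = expR (h * b - 2 + - (g * b)) * (M * M / (b + 1) ^+ 2).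
  by rewrite [in RHS]expRD; field; rewrite gt_eqF.
rewrite mulr_ile1 ?expR_ge0//.
- by rewrite divr_ge0 ?exprn_ge0 ?mulr_ge0// ltW.
- by rewrite -[leRHS]expR0 ler_expR.
- by rewrite ler_pdivrMr ?exprn_gt0// mul1r.
Qed.
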